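(* Let $\mathbb{D}$ be a countable set, $(G,+)$ a commutative group, and $V$ a finite, reversible set of data vectors $\mathbb{D}\to G$ with $\bigcup_{\vec{v}\in V}\mathrm{supp}(\vec{v})\subsetneq\mathbb{D}$. A data vector $\vec{x}:\mathbb{D}\to G$ is a permutation sum of $V$ if and only if (1) $\mathrm{weight}(\vec{x})$ lies in the subgroup of $G$ generated by $\{\mathrm{weight}(\vec{v})\mid\vec{v}\in V\}$, and (2) for every $\alpha\in\mathbb{D}$, $\vec{x}(\alpha)$ lies in the subgroup of $G$ generated by $\{\vec{v}(\delta)\mid\delta\in\mathbb{D},\ \vec{v}\in V\}$.
   Context: A data vector is a function $\mathbb{D}\to G$ with finite support $\mathrm{supp}(\vec{v})=\{\alpha\mid\vec{v}(\alpha)\neq0\}$; addition and negation are pointwise. $\vec{y}$ is a permutation sum of $V$ if $\vec{y}=\sum_{i=1}^n\vec{v_i}\circ\theta_i$ for some $n\in\mathbb{N}$, $\vec{v_i}\in V$ (repetitions allowed) and permutations $\theta_i$ of $\mathbb{D}$. $V$ is reversible if for every $\vec{v}\in V$ both $\vec{v}$ and $-\vec{v}$ are permutation sums of $V$. $\mathrm{weight}(\vec{v})=\sum_{\alpha\in\mathbb{D}}\vec{v}(\alpha)$. *)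

(* Defs.v *)
From mathcomp Require Export all_boot all_algebra.
From mathcomp Require Export all_classical.

Set Implicit Arguments.
Unset Strict Implicit.
Unset Printing Implicit Defensive.

Import GRing.Theory.

Local Open Scope classical_set_scope.
Local Open Scope ring_scope.

Definition supp (D : Type) (G : zmodType) (v : D -> G) : set D :=
  [set a | v a != 0].

Definition data_vector (D : Type) (G : zmodType) (v : D -> G) : Prop :=
  finite_set (supp v).

(* The sum over [set: D] ranges over the support of v when that is finite;
   it is 0 by convention if v has infinite support. *)
Definition weight (D : choiceType) (G : zmodType) (v : D -> G) : G :=
  \sum_(a \in [set: D]) v a.

(* The sum is taken in the pointwise zmodType structure on D -> G; n = 0 is
   allowed, so the zero vector is always a permutation sum. *)
Definition permutation_sum (D : Type) (G : zmodType)
    (V : set (D -> G)) (y : D -> G) : Prop :=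
  exists (n : nat) (v : 'I_n -> D -> G) (theta : 'I_n -> D -> D),
    [/\ forall i, V (v i),
        forall i, bijective (theta i)
      & y = \sum_(i < n) (v i \o theta i)].

Definition reversible (D : Type) (G : zmodType) (V : set (D -> G)) : Prop :=
  forall v, V v -> permutation_sum V v /\ permutation_sum V (- v).

Definition gen_subgroup (G : zmodType) (S : set G) : set G :=
  smallest (fun H : set G => zmod_closed (mem H)) S.

(* Main.v *)
(** Write [g e_a] for the vector with value [g] at [a] and [0] elsewhere.  By
    reversibility the permutation sums of V form a group, closed under
    permutations of D.  Let [a] be outside all supports.  For [v] in V, exchanging
    [d] and [a] in [v] and subtracting gives [v(d) (e_d - e_a)]; hence every
    [g (e_b - e_a)] with [g] in the group generated by the values of V is a
    permutation sum.  Modulo these, a vector [x] with values in that group equals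
    [weight(x) e_a].  Applied to the members of V, this shows that [g e_a] is a
    permutation sum for each [g] in the group generated by the weights of V. *)

Require Import Defs.

Import GRing.Theory.

Local Open Scope classical_set_scope.
Local Open Scope ring_scope.

(** * Subgroups generated by a set *)

Section GeneratedSubgroup.
Context {G : zmodType}.
Implicit Types S K : set G.

Lemma zmod_closed_gen_subgroup S : zmod_closed (mem (gen_subgroup S)).
Proof.
split=> [|g h]; rewrite ?inE; first by move=> H [[H0 _] _]; move: H0; rewrite inE.
move=> Sg Sh H HS; case: (HS) => -[_ HB] _.
by have /(_ _ _)/[!inE] := HB g h; apply; [exact: Sg | exact: Sh].
Qed.

Lemma gen_subgroup0 S : gen_subgroup S 0.
Proof. by have [/[!inE]] := zmod_closed_gen_subgroup S. Qed.

Lemma gen_subgroupB S g h :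
  gen_subgroup S g -> gen_subgroup S h -> gen_subgroup S (g - h).
Proof.
by have [_ /(_ g h)/[!inE] SB] := zmod_closed_gen_subgroup S; apply: SB.
Qed.

Lemma gen_subgroupD S g h :
  gen_subgroup S g -> gen_subgroup S h -> gen_subgroup S (g + h).
Proof.
move=> Sg Sh; rewrite -[h]opprK -[- h]sub0r.
by do 2!apply: gen_subgroupB => //; exact: gen_subgroup0.
Qed.

Lemma mem_gen_subgroup S g : S g -> gen_subgroup S g.
Proof. exact: sub_gen_smallest. Qed.

(** Serves as the induction principle for generated subgroups: [K] is itself one of the subgroups
    that are intersected. *)
Lemma gen_subgroup_sub S K :
    K 0 -> (forall g h, K g -> K h -> K (g - h)) -> S `<=` K ->
  gen_subgroup S `<=` K.
Proof.
move=> K0 KB SK; apply: smallest_sub => //; split=> [|g h]; rewrite !inE //.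
exact: KB.
Qed.

End GeneratedSubgroup.

(** * Finite supports and weights *)

Section Weight.
Context {D : choiceType} {G : zmodType}.
Implicit Types v w : D -> G.

Lemma weight_seq v (s : seq D) :
  uniq s -> supp v `<=` [set` s] -> weight v = \sum_(a <- s) v a.
Proof.
move=> s_uniq vs; rewrite (fsbig_seq _ v s_uniq) /weight.
apply/esym/fsbig_widen => // a [_ /= /negP as_].
by apply/eqP/negPn/negP => va; move/negP: as_; apply; exact: (vs a).
Qed.

Lemma data_vector_seq v :
  data_vector v -> exists2 s : seq D, uniq s & supp v `<=` [set` s].
Proof.
move=> /finite_seqP[s vs]; exists (undup s); first exact: undup_uniq.
by rewrite vs => a /=; rewrite mem_undup.
Qed.

Lemma data_vector0 : data_vector (0 : D -> G).
Proof.
by rewrite /data_vector (_ : supp _ = set0) // -subset0 => a /=; rewrite /supp /= eqxx.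
Qed.

Lemma data_vectorD v w : data_vector v -> data_vector w -> data_vector (v + w).
Proof.
move=> fv fw; apply: (@sub_finite_set _ _ (supp v `|` supp w)); last first.
  by rewrite finite_setU.
move=> a; rewrite /supp /= => vwa; apply/orP; rewrite -negb_and.
by apply: contra vwa => /andP[/eqP va /eqP wa]; apply/eqP; rewrite fctE va wa addr0.
Qed.

Lemma data_vector_comp v (theta : D -> D) :
  injective theta -> data_vector v -> data_vector (v \o theta).
Proof. by move=> th_inj fv; apply: finite_preimage fv => a b _ _ /th_inj. Qed.

Lemma weight0 : weight (0 : D -> G) = 0.
Proof. by rewrite (@weight_seq _ [::]) ?big_nil // => a /=; rewrite /supp /= eqxx. Qed.

Lemma weightD v w :
  data_vector v -> data_vector w -> weight (v + w) = weight v + weight w.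
Proof.
move=> fv fw.
have /finite_seqP[s vws] : finite_set (supp v `|` supp w) by rewrite finite_setU.
(* One list covers the supports of [v], [w] and [v + w], so all three weights become sums over
   it. *)
have sub (u : D -> G) : (forall a, v a = 0 -> w a = 0 -> u a = 0) ->
    weight u = \sum_(a <- undup s) u a.
  move=> u0; apply: weight_seq; first exact: undup_uniq.
  move=> a ua; rewrite /= mem_undup.
  suff : [set` s] a by [].
  rewrite -vws; apply: contrapT => /not_orP[va wa].
  by move/eqP: ua; apply; apply: u0; apply/eqP/negPn/negP.
rewrite !sub // -?big_split // => a va wa.
by rewrite fctE va wa addr0.
Qed.

Lemma weight_comp v (theta : D -> D) : bijective theta -> weight (v \o theta) = weight v.
Proof. by move=> th_bij; rewrite /weight (reindex_fsbigT theta v th_bij). Qed.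

End Weight.

(** * One-point vectors and transpositions *)

Definition single {D : eqType} {G : zmodType} (a : D) (g : G) : D -> G :=
  fun b => if b == a then g else 0.

Lemma single0 {D : eqType} {G : zmodType} (a : D) : single a (0 : G) = 0.
Proof. by apply/funext => b; rewrite /single; case: ifP. Qed.

Lemma singleB {D : eqType} {G : zmodType} (a : D) (g h : G) :
  single a (g - h) = single a g - single a h.
Proof. by apply/funext => b; rewrite !fctE /single; case: ifP; rewrite ?subr0. Qed.

Lemma single_sum {D : eqType} {G : zmodType} (a : D) (I : Type) (r : seq I) (F : I -> G) :
  single a (\sum_(i <- r) F i) = \sum_(i <- r) single a (F i).
Proof.
apply/funext => b; rewrite fct_sumE /single; case: ifP => // _.
by rewrite big1.
Qed.

Lemma sum_single {D : eqType} {G : zmodType} (v : D -> G) (s : seq D) :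
  uniq s -> supp v `<=` [set` s] -> v = \sum_(b <- s) single b (v b).
Proof.
move=> s_uniq vs; apply/funext => c; rewrite fct_sumE.
have [cs|cs] := boolP (c \in s).
  rewrite (bigD1_seq c) //= {1}/single eqxx big1 ?addr0 // => b bc.
  by rewrite /single eq_sym (negbTE bc).
rewrite big_seq big1; last first.
  by move=> b bs; rewrite /single; case: eqP cs => // -> /negP[].
by apply/eqP/negPn/negP => /vs /=; apply/negP.
Qed.

Definition swap {D : eqType} (a b c : D) : D :=
  if c == a then b else if c == b then a else c.

Lemma swapK {D : eqType} (a b : D) : involutive (swap a b).
Proof.
move=> c; rewrite /swap /=; have [->|ca] := eqVneq c a.
  by rewrite eqxx; case: eqVneq.
have [->|cb] := eqVneq c b; first by rewrite eqxx.
by rewrite (negbTE ca) (negbTE cb).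
Qed.

Lemma swap_bij {D : eqType} (a b : D) : bijective (swap a b).
Proof. exact: inv_bij (swapK a b). Qed.

(** The transposition moves [v b] to [a] and the zero at [a] to [b]; all other entries cancel. For
    [a = b] both sides vanish. *)
Lemma sub_comp_swap {D : eqType} {G : zmodType} (v : D -> G) (a b : D) :
  v a = 0 -> v - (v \o swap b a) = single b (v b) - single a (v b).
Proof.
move=> va; apply/funext => c; rewrite !fctE /= /single /swap.
have [->|cb] := eqVneq c b.
  by have [->|_] := eqVneq b a; rewrite va ?subrr.
by have [->|ca] := eqVneq c a; rewrite ?va // !subrr.
Qed.

(** * The group of permutation sums *)

Section PermutationSum.
Context {D : choiceType} {G : zmodType} {V : set (D -> G)}.
Implicit Types v x y z : D -> G.

Lemma permutation_sum0 : permutation_sum V 0.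
Proof.
exists 0%N, (fun=> 0), (fun=> id); split; try by case.
by rewrite big_ord0.
Qed.

Lemma permutation_sum_perm v theta :
  V v -> bijective theta -> permutation_sum V (v \o theta).
Proof.
move=> Vv th_bij; exists 1%N, (fun=> v), (fun=> theta); split=> //.
by rewrite big_ord1.
Qed.

Lemma permutation_sumD y z :
  permutation_sum V y -> permutation_sum V z -> permutation_sum V (y + z).
Proof.
move=> [m [v [th [Vv bth ->]]]] [n [w [et [Vw bet ->]]]].
exists (m + n)%N, (fun i => match fintype.split i with inl j => v j | inr k => w k end),
  (fun i => match fintype.split i with inl j => th j | inr k => et k end).
split=> [i|i|]; try by case: fintype.split.
rewrite big_split_ord /=; congr (_ + _); apply: eq_bigr => i _.
  by rewrite (unsplitK (inl i)).
by rewrite (unsplitK (inr i)).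
Qed.

Lemma permutation_sum_ind (Q : (D -> G) -> Prop) :
    Q 0 -> (forall y z, Q y -> Q z -> Q (y + z)) ->
    (forall v theta, V v -> bijective theta -> Q (v \o theta)) ->
  forall y, permutation_sum V y -> Q y.
Proof.
move=> Q0 QD Qv y [n [v [th [Vv bth ->]]]].
by apply: big_ind => // i _; apply: Qv.
Qed.

Lemma permutation_sum_comp y theta :
  bijective theta -> permutation_sum V y -> permutation_sum V (y \o theta).
Proof.
move=> bth; elim/permutation_sum_ind => [|u w Pu Pw|v et Vv bet].
- exact: permutation_sum0.
- exact: permutation_sumD Pu Pw.
- apply: (@permutation_sum_perm v (et \o theta)) => //; exact: bij_comp.
Qed.

Hypothesis V_rev : reversible V.

Lemma permutation_sumN y : permutation_sum V y -> permutation_sum V (- y).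
Proof.
elim/permutation_sum_ind => [|u w Pu Pw|v th Vv bth].
- by rewrite oppr0; exact: permutation_sum0.
- by rewrite opprD; exact: permutation_sumD.
(* Negation is pointwise, so it commutes with precomposition by [th]. *)
- by apply: (@permutation_sum_comp (- v)) => //; case: (V_rev _ Vv).
Qed.

Lemma permutation_sumB y z :
  permutation_sum V y -> permutation_sum V z -> permutation_sum V (y - z).
Proof. by move=> Py Pz; apply: permutation_sumD => //; exact: permutation_sumN. Qed.

Variable a : D.
Hypothesis aV : forall v, V v -> v a = 0.

Let values := [set g : G | exists v d, V v /\ g = v d].

Lemma permutation_sum_dipole g b :
  gen_subgroup values g -> permutation_sum V (single b g - single a g).
Proof.
move=> genv; move: g genv b.
apply: (@gen_subgroup_sub _ values
  [set g | forall b, permutation_sum V (single b g - single a g)]) => /=.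
- by move=> b; rewrite !single0 subr0; exact: permutation_sum0.
- move=> g h Pg Ph b; rewrite !singleB.
  by rewrite opprD addrACA -opprD; apply: permutation_sumB.
- move=> _ [v [d [Vv ->]]] b.
  have [->|ba] := eqVneq b a; first by rewrite subrr; exact: permutation_sum0.
  have [->|da] := eqVneq d a.
    by rewrite aV // !single0 subrr; exact: permutation_sum0.
  (* Exchanging [b] and [d] brings the value [v d] to [b] and keeps the zero at [a], since [a]
     differs from both. The difference of [w] and its transpose under [swap b a] is then the desired
     vector. *)
  set w := v \o swap b d.
  have Pw : permutation_sum V w by exact: permutation_sum_perm (swap_bij b d).
  have wb : w b = v d by rewrite /w /= /swap eqxx.
  have wa : w a = 0.
    by rewrite /w /= /swap eq_sym (negbTE ba) eq_sym (negbTE da) aV.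
  rewrite -wb -(sub_comp_swap _ _ _ wa); apply: permutation_sumB => //.
  exact: permutation_sum_comp (swap_bij b a) Pw.
Qed.

(** Both [x] and [single a (weight x)] split into sums over the support of [x], and their termwise
    differences are the vectors [single b (x b) - single a (x b)]. *)
Lemma permutation_sum_concentrate x :
    data_vector x -> (forall b, gen_subgroup values (x b)) ->
  permutation_sum V (x - single a (weight x)).
Proof.
move=> /data_vector_seq[s s_uniq xs] genx.
rewrite (weight_seq _ _ s_uniq xs) single_sum.
rewrite {1}(sum_single _ _ s_uniq xs) -sumrB.
apply: big_ind => [||b _]; first exact: permutation_sum0.
  exact: permutation_sumD.
exact: permutation_sum_dipole.
Qed.

Lemma permutation_sum_weight g :
    (forall v, V v -> data_vector v) ->
    gen_subgroup [set weight v | v in V] g ->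
  permutation_sum V (single a g).
Proof.
move=> V_data; move: g; apply: gen_subgroup_sub => /= [|g h|_ [v Vv <-]].
- by rewrite single0; exact: permutation_sum0.
- by rewrite singleB; exact: permutation_sumB.
(* Write [single a (weight v)] as [v - (v - single a (weight v))]; concentration at [a] applies to
   the inner difference. *)
- rewrite -[single _ _](subKr v); apply: permutation_sumB.
    by case: (V_rev _ Vv).
  apply: permutation_sum_concentrate; first exact: V_data.
  by move=> b; apply: mem_gen_subgroup; exists v, b.
Qed.

End PermutationSum.

Theorem theorem15 (D : countType) (G : zmodType) (V : set (D -> G))
    (V_data : forall v, V v -> data_vector v)
    (V_finite : finite_set V)
    (V_rev : reversible V)
    (V_supp : \bigcup_(v in V) supp v `<` [set: D])
    (x : D -> G) (x_data : data_vector x) :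
  permutation_sum V x <->
    gen_subgroup [set weight v | v in V] (weight x) /\
    (forall a : D,
       gen_subgroup [set g | exists v d, V v /\ g = v d] (x a)).
Proof.
split=> [Px|[wx vx]].
  split=> [|a]; last first.
    move: x Px {x_data}; apply: permutation_sum_ind => [|y z|v th Vv _].
    - exact: gen_subgroup0.
    - exact: gen_subgroupD.
    - by apply: mem_gen_subgroup; exists v, (th a).
  (* Finite support is carried through the induction because additivity of [weight] requires it. *)
  suff [] : data_vector x /\ gen_subgroup [set weight v | v in V] (weight x) by [].
  move: x Px {x_data}; apply: permutation_sum_ind => [|y z [fy Vy] [fz Vz]|v th Vv bth].
  - by rewrite weight0; split; [exact: data_vector0 | exact: gen_subgroup0].
  - by rewrite weightD //; split; [exact: data_vectorD | exact: gen_subgroupD].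
  - split; first by apply: data_vector_comp; [exact: bij_inj | exact: V_data].
    by rewrite weight_comp //; apply: mem_gen_subgroup; exists v.
(* Strictness of the inclusion supplies a point [a] where every member of [V] vanishes. *)
have [_ /existsNP[a /not_implyP[_ aV]]] := V_supp.
have {}aV v : V v -> v a = 0.
  by move=> Vv; apply/eqP/negPn/negP => va; apply: aV; exists v.
(* Condition (2) handles [x - single a (weight x)], and condition (1) handles
   [single a (weight x)]. *)
rewrite -[x](subrK (single a (weight x))); apply: permutation_sumD.
  exact: permutation_sum_concentrate.
exact: permutation_sum_weight.
Qed.
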